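(* Let $\mu:L^\infty(\mathbb{R})\to\mathbb{R}$ be a translation-invariant valuation. Then $\mu(u)=0$ for every $u\in L^\infty(\mathbb{R})$ with compact support.
   Context: $L^\infty(\mathbb{R})$ is the usual space of essentially bounded Lebesgue measurable functions $\mathbb{R}\to\mathbb{R}$, with functions that agree almost everywhere identified. For $u,v\in L^\infty(\mathbb{R})$, $u\lor v$ and $u\land v$ denote the pointwise maximum and minimum, and $\mathbf{0}$ is the function constantly equal to $0$. A valuation on $L^\infty(\mathbb{R})$ is a map $\mu:L^\infty(\mathbb{R})\to\mathbb{R}$ with $\mu(u\lor v)+\mu(u\land v)=\mu(u)+\mu(v)$ for all $u,v\in L^\infty(\mathbb{R})$ and $\mu(\mathbf{0})=0$. No continuity or monotonicity is assumed. For $t\in\mathbb{R}$ set $\mathcal{T}_t u(x):=u(x-t)$; $\mu$ is translation-invariant if $\mu(\mathcal{T}_t u)=\mu(u)$ for all $u\in L^\infty(\mathbb{R})$ and all $t\in\mathbb{R}$. A function $u\in L^\infty(\mathbb{R})$ has compact support if it vanishes almost everywhere outside a bounded interval. *)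

(* Defs.v *)
From HB Require Import structures.
From mathcomp Require Import all_boot all_order all_algebra generic_quotient.
From mathcomp Require Import all_classical all_reals all_analysis.
From mathcomp Require Import measurable_realfun ess_sup_inf hoelder.

Set Implicit Arguments.
Unset Strict Implicit.
Unset Printing Implicit Defensive.
Import Order.TTheory GRing.Theory Num.Theory.
Import numFieldNormedType.Exports.

Local Open Scope classical_set_scope.
Local Open Scope ring_scope.

(* The line with the sigma-algebra of all Lebesgue measurable sets, not only
   the Borel sets. *)
Notation LebR R := (caratheodory_type (@wlength R idfun)^*%mu).

Definition leb {R : realType} : {measure set (LebR R) -> \bar R} :=
  @completed_lebesgue_measure R.

Definition Linf (R : realType) : Type := LspaceType (@leb R) (leey 1).

(* Evaluation of a class goes through the library's choice of a representative,
   so u x is meaningful only up to null sets. *)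
Definition Linf_fun {R : realType} (u : Linf R) : LebR R -> R :=
  (u : {mfun_ leb, LebR R >-> measurableTypeR R}).
Coercion Linf_fun : Linf >-> Funclass.

Section Translate.
Context {R : realType}.
Implicit Types (t : R) (X Y : set (LebR R)) (f : LebR R -> R).

Definition translate {T : Type} t (f : LebR R -> T) : LebR R -> T :=
  fun x => f ((x : R) - t).

Lemma translate_itv t (a b : R) :
  translate t `]a, b]%classic = `]a + t, b + t]%classic.
Proof.
by apply/seteqP; split=> x; rewrite /translate /= !in_itv /= ltrBrDr lerBlDr.
Qed.

Lemma translateK {T : Type} t (f : LebR R -> T) : translate (- t) (translate t f) = f.
Proof. by apply/funext => x; rewrite /translate opprK addrK. Qed.

Lemma translateNK {T : Type} t (f : LebR R -> T) :
  translate t (translate (- t) f) = f.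
Proof. by rewrite -[X in translate X _]opprK translateK. Qed.

Let translate_setI t X Y : translate t (X `&` Y) = translate t X `&` translate t Y.
Proof. by []. Qed.

Let translate_setC t X : translate t (~` X) = ~` translate t X.
Proof. by []. Qed.

Let translate_leb_le t X : ((@leb R) (translate t X) <= leb X)%E.
Proof.
apply: le_ereal_inf_tmp => _ [F [mF XF] <-]; apply: ereal_inf_lbound.
exists (fun k => translate t (F k)); first split=> [k|x].
- by have [[a b] _ <-] := mF k; rewrite translate_itv; exact: is_ocitv.
- by move=> /XF [k _ Fk]; exists k.
apply: eq_eseriesr => k _; have [[a b] _ <-] := mF k.
rewrite translate_itv; apply: etrans (wlength_itv _ _) _.
apply/esym; apply: etrans (wlength_itv _ _) _ => /=.
by rewrite !lte_fin ltrD2r -!EFinB [in RHS]opprD addrACA subrr addr0.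
Qed.

Lemma translate_leb t X : (@leb R) (translate t X) = leb X.
Proof.
apply/eqP; rewrite eq_le translate_leb_le /=.
by have := translate_leb_le (- t) (translate t X); rewrite translateK.
Qed.

Lemma measurable_translate t X : measurable X ->
  measurable (translate t X : set (LebR R)).
Proof.
move=> mX; suff : caratheodory_measurable (@leb R) (translate t X) by [].
have {}mX : caratheodory_measurable (@leb R) X by [].
move=> Y; rewrite -(translateNK t Y).
rewrite -translate_setI -translate_setC -translate_setI !translate_leb.
by rewrite -mX translate_leb.
Qed.

Lemma ae_translate t (P : set (LebR R)) :
  (\forall x \ae (@leb R), P x) -> \forall x \ae (@leb R), translate t P x.
Proof.
move=> [N [mN N0 PN]]; exists (translate t N); split.
- exact: measurable_translate.
- by rewrite translate_leb.
- by move=> x /PN.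
Qed.

End Translate.

Section Class.
Context {R : realType}.
Implicit Types (u v : Linf R) (f g : LebR R -> R).

Lemma ae_finite_norm f g : f = g %[ae @leb R] ->
  finite_norm leb +oo f -> finite_norm leb +oo g.
Proof.
move=> fg; rewrite /finite_norm unlock /Lnorm; case: ifPn => // _.
congr (_ < _)%E; apply: eq_ess_sup.
by apply: filterS fg => x /(_ I) /= ->.
Qed.

Section Of.
Variables (f : LebR R -> R) (hf : f \in Lfun (@leb R) +oo).

Let mf : measurable_fun setT (f : LebR R -> measurableTypeR R).
Proof. by move: hf; rewrite inE => /andP[/[!inE]]. Qed.

Let F : {mfun LebR R >-> measurableTypeR R} :=
  HB.pack (f : LebR R -> measurableTypeR R)
    (@isMeasurableFun.Build _ _ (LebR R) (measurableTypeR R) f mf).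

Let pF : {mfun_ leb, LebR R >-> measurableTypeR R} :=
  (\pi_({mfun_ leb, LebR R >-> measurableTypeR R}) F)%qT.

Let pFE : pF = f %[ae @leb R].
Proof.
by have /eqquotP/asboolP := reprK pF.
Qed.

Let bF : finite_norm leb +oo pF.
Proof.
apply: (@ae_finite_norm f); first exact: ae_eq_sym.
by move: hf; rewrite inE => /andP[_]; rewrite inE.
Qed.

Definition Linf_of : Linf R :=
  HB.pack pF (isFinLebesgue.Build _ _ _ leb +oo%E (leey 1) pF bF).

Lemma Linf_ofE : Linf_of = f %[ae @leb R].
Proof. exact: pFE. Qed.

End Of.
End Class.

Section Lattice.
Context {R : realType}.
Implicit Types (u v : Linf R) (f g : LebR R -> R) (t : R).

Lemma LfunyP f :
  f \in Lfun (@leb R) +oo <->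
  measurable_fun setT f /\ exists M, \forall x \ae (@leb R), `|f x| <= M.
Proof.
have leb_gt0 : (0 < (@leb R) setT)%E.
  suff -> : leb setT = (+oo : \bar R)%E by rewrite ltry.
  by have := @lebesgue_measure_itv R `]-oo, +oo[; rewrite set_itvE.
split=> [/andP[/[!inE]/= mf]|[mf [M fM]]].
  rewrite /finite_norm unlock /= leb_gt0 => fy; split=> //.
  have [M fM] : exists M : R, (ess_sup leb (abse \o (EFin \o f)) <= M%:E)%E.
    case: (ess_sup _ _) fy => [r _|//|_]; first by exists r.
    by exists 0; rewrite leNye.
  by exists M; move/ess_supP: fM; apply: filterS => x /=; rewrite lee_fin.
apply/andP; split; rewrite inE //= /finite_norm unlock /= leb_gt0.
apply: (@le_lt_trans _ _ M%:E); last exact: ltry.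
by apply/ess_supP; apply: filterS fM => x /=; rewrite lee_fin.
Qed.

Lemma LinfP u : (u : LebR R -> R) \in Lfun (@leb R) +oo.
Proof.
rewrite inE; apply/andP; split; rewrite inE /=.
  exact: (@measurable_funPT _ _ _ _ (repr (u : {mfun_ leb, LebR R >-> measurableTypeR R}))).
exact: Lebesgue_finite.
Qed.

Lemma Linf_eqP u v : u = v <-> u = v %[ae @leb R].
Proof.
split=> [->|]; first exact: ae_eq_refl.
case: u v => [f [[hf]]] [g [[hg]]] fg.
have {}fg : f = g by rewrite -[f]reprK -[g]reprK; exact/eqquotP/asboolP.
by rewrite fg in hf *; rewrite (Prop_irrelevance hf hg).
Qed.

Lemma Lfuny_max f g : f \in Lfun (@leb R) +oo -> g \in Lfun (@leb R) +oo ->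
  f \max g \in Lfun (@leb R) +oo.
Proof.
move=> /LfunyP[mf [M fM]] /LfunyP[mg [N gN]]; apply/LfunyP.
split; first exact: measurable_maxr.
exists (Num.max M N); apply: filterS2 fM gN => x fM gN /=.
by rewrite le_max; case: (leP (f x) (g x)) => _; rewrite ?fM ?gN ?orbT.
Qed.

Lemma Lfuny_min f g : f \in Lfun (@leb R) +oo -> g \in Lfun (@leb R) +oo ->
  f \min g \in Lfun (@leb R) +oo.
Proof.
move=> /LfunyP[mf [M fM]] /LfunyP[mg [N gN]]; apply/LfunyP.
split; first exact: measurable_minr.
exists (Num.max M N); apply: filterS2 fM gN => x fM gN /=.
by rewrite le_max; case: (leP (f x) (g x)) => _; rewrite ?fM ?gN ?orbT.
Qed.

Lemma Lfuny_translate t f : f \in Lfun (@leb R) +oo ->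
  translate t f \in Lfun (@leb R) +oo.
Proof.
move=> /LfunyP[mf [M fM]]; apply/LfunyP; split; last first.
  by exists M; exact: (ae_translate t fM).
move=> _ B mB; rewrite setTI.
have := mf measurableT B mB; rewrite setTI.
exact: measurable_translate.
Qed.

Lemma Lfuny_cst0 : cst 0 \in Lfun (@leb R) +oo.
Proof.
by apply/LfunyP; split=> //; exists 0; apply: aeW => x /=; rewrite normr0.
Qed.

Definition Linf0 : Linf R := Linf_of Lfuny_cst0.

Definition Linf_max u v : Linf R := Linf_of (Lfuny_max (LinfP u) (LinfP v)).

Definition Linf_min u v : Linf R := Linf_of (Lfuny_min (LinfP u) (LinfP v)).

Definition Linf_translate t u : Linf R := Linf_of (Lfuny_translate t (LinfP u)).

Lemma Linf_of_eq f g (hf : f \in Lfun (@leb R) +oo)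
    (hg : g \in Lfun (@leb R) +oo) :
  Linf_of hf = Linf_of hg <-> f = g %[ae @leb R].
Proof.
rewrite Linf_eqP; have [hf' hg'] := (Linf_ofE hf, Linf_ofE hg).
split=> fg; first exact: ae_eq_trans (ae_eq_sym hf') (ae_eq_trans fg hg').
exact: ae_eq_trans hf' (ae_eq_trans fg (ae_eq_sym hg')).
Qed.

(* Linf_max, Linf_min and Linf_translate apply the pointwise operation to the
   library's chosen representatives; the next three lemmas say that any other
   representatives give the same class. *)
Lemma Linf_max_of f g (hf : f \in Lfun (@leb R) +oo)
    (hg : g \in Lfun (@leb R) +oo) :
  Linf_max (Linf_of hf) (Linf_of hg) = Linf_of (Lfuny_max hf hg).
Proof.
apply/Linf_of_eq; have [hf' hg'] := (Linf_ofE hf, Linf_ofE hg).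
by apply: filterS2 hf' hg' => x /(_ I) /= -> /(_ I) /= ->.
Qed.

Lemma Linf_min_of f g (hf : f \in Lfun (@leb R) +oo)
    (hg : g \in Lfun (@leb R) +oo) :
  Linf_min (Linf_of hf) (Linf_of hg) = Linf_of (Lfuny_min hf hg).
Proof.
apply/Linf_of_eq; have [hf' hg'] := (Linf_ofE hf, Linf_ofE hg).
by apply: filterS2 hf' hg' => x /(_ I) /= -> /(_ I) /= ->.
Qed.

Lemma Linf_translate_of t f (hf : f \in Lfun (@leb R) +oo) :
  Linf_translate t (Linf_of hf) = Linf_of (Lfuny_translate t hf).
Proof.
apply/Linf_of_eq; have H := ae_translate t (Linf_ofE hf).
by apply: filterS H => x Hx _; exact: Hx.
Qed.

End Lattice.

Section Valuation.
Context {R : realType}.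
Implicit Types (mu : Linf R -> R) (u : Linf R).

Definition valuation mu : Prop :=
  (forall u v, mu (Linf_max u v) + mu (Linf_min u v) = mu u + mu v) /\
  mu Linf0 = 0.

Definition translation_invariant mu : Prop :=
  forall u t, mu (Linf_translate t u) = mu u.

Definition compact_support u : Prop :=
  exists a b : R, \forall x \ae (@leb R), x \notin `[a, b] -> u x = 0.

End Valuation.

(* Main.v *)
(* An Eilenberg swindle.  Let u have a constant sign and vanish a.e. outside
   [a, a + L[, and let v be the sum of the translates of u by 0, L, 2L, ...  Then
   v is bounded and {v, 0} are the join and the meet (in the order given by the
   sign of u) of u and T_L v, so that mu v = mu u + mu (T_L v) = mu u + mu v.
   A general u is handled through its positive and negative parts. *)
Require Import Defs.
From HB Require Import structures.
From mathcomp Require Import all_boot all_order all_algebra.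
From mathcomp Require Import all_classical all_reals all_analysis.
From mathcomp Require Import lra.
Import Order.TTheory GRing.Theory Num.Theory.
Import numFieldNormedType.Exports.
Local Open Scope ring_scope.

Section HalfPeriodization.
Local Open Scope classical_set_scope.
Local Open Scope ring_scope.
Context {R : realType}.
Implicit Types (f : LebR R -> R) (a L : R).

(* The sum of the translates of the restriction of f to [a, a + L[ by L * k,
   k : nat. *)
Definition half_periodization a L f : LebR R -> R := fun x =>
  if (x : R) < a then 0
  else translate (L * (Num.truncn (((x : R) - a) / L))%:R) f x.

Lemma measurable_itv_leb (i : interval R) :
  measurable ([set` i]%classic : set (LebR R)).
Proof. by apply: sub_caratheodory; exact: measurable_itv. Qed.

Lemma half_periodization_lt a L f (x : R) :
  x < a -> half_periodization a L f x = 0.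
Proof. by rewrite /half_periodization => ->. Qed.

Lemma half_periodization_itv a L f (k : nat) (x : R) : 0 < L ->
  a + L * k%:R <= x < a + L * k.+1%:R ->
  half_periodization a L f x = translate (L * k%:R) f x.
Proof.
move=> L0 /andP[kx xk]; have kL : 0 <= L * k%:R by rewrite mulr_ge0// ltW.
have -> : half_periodization a L f x =
    translate (L * (Num.truncn ((x - a) / L))%:R) f x.
  by rewrite /half_periodization ltNge (le_trans _ kx)//; lra.
congr (translate (_ * _%:R) f x); apply: truncn_def.
by rewrite ler_pdivlMr// ltr_pdivrMr//; apply/andP; split; lra.
Qed.

Lemma itv_cover a L (x : R) : 0 < L -> a <= x ->
  exists k : nat, a + L * k%:R <= x < a + L * k.+1%:R.
Proof.
move=> L0 ax; exists (Num.truncn ((x - a) / L)).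
have : 0 <= (x - a) / L by rewrite divr_ge0 ?subr_ge0// ltW.
move=> /truncn_itv; rewrite ler_pdivlMr// ltr_pdivrMr// => /andP[h1 h2].
by apply/andP; split; lra.
Qed.

(** The half-line left of [a] and the countably many periods [I k] cover the line; the function is 0
    on the first and a translate of [f] on each of the others. *)
Lemma measurable_half_periodization a L f : 0 < L -> measurable_fun setT f ->
  measurable_fun setT (half_periodization a L f).
Proof.
move=> L0 mf.
pose I k : set (LebR R) := `[a + L * k%:R, a + L * k.+1%:R[%classic.
have -> : setT = (`]-oo, a[%classic : set (LebR R)) `|` \bigcup_k I k.
  apply/esym/seteqP; split=> // x _; have [xa|ax] := ltP (x : R) a.
    by left; rewrite /= in_itv.
  right; have [k hk] := itv_cover a L x L0 ax.
  by exists k => //; rewrite /I /= in_itv.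
have mI k : measurable (I k) by exact: measurable_itv_leb.
apply/measurable_funU; [exact: measurable_itv_leb|exact: bigcup_measurable|].
split.
  apply: (@eq_measurable_fun _ _ (LebR R) R _ (cst (0 : R))) => // x; rewrite inE /= in_itv /= => xa.
  by rewrite half_periodization_lt.
apply/measurable_fun_bigcup => // k.
apply: (eq_measurable_fun (translate (L * k%:R) f)).
  by move=> x; rewrite inE /I /= in_itv /= => /(half_periodization_itv a L f k x L0) ->.
apply: (@measurable_funS _ _ _ _ setT) => // _ B mB; rewrite setTI.
by have := mf measurableT B mB; rewrite setTI; exact: measurable_translate.
Qed.

(** Each value is 0 or a value of one of countably many translates of [f], whose exceptional null
    sets have a null union. This carries both bounds and signs over from [f]. *)
Lemma ae_half_periodization a L f (P : set R) : 0 < L -> P 0 ->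
  (\forall x \ae (@leb R), P (f x)) ->
  \forall x \ae (@leb R), P (half_periodization a L f x).
Proof.
move=> L0 P0 Pf.
have : \forall x \ae (@leb R),
    forall k : nat, P (translate (L * k%:R) f x).
  by apply/ae_foralln => k; exact: (ae_translate (L * k%:R) Pf).
apply: filterS => x xP.
have [xa|ax] := ltP (x : R) a; first by rewrite half_periodization_lt.
have [k hk] := itv_cover a L x L0 ax.
by rewrite (half_periodization_itv a L f k x).
Qed.

Lemma Lfuny_half_periodization a L f : 0 < L -> f \in Lfun (@leb R) +oo ->
  half_periodization a L f \in Lfun (@leb R) +oo.
Proof.
move=> L0 /LfunyP[mf [M fM]]; apply/LfunyP.
split; first exact: measurable_half_periodization.
(* The maximum with 0 makes the bound hold at the value 0, without a proof of [0 <= M]. *)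
exists (Num.max M 0).
apply: (ae_half_periodization a L f [set y | `|y| <= Num.max M 0] L0).
  by rewrite /= normr0 le_max lexx orbT.
by apply: filterS fM => x fxM /=; rewrite le_max fxM.
Qed.

(** Shifting by one period only removes the copy of [f] on [[a, a + L[]. The support condition is
    imposed at the single point [x], so that the lemma applies almost everywhere. *)
Lemma half_periodization_shift a L f (x : R) : 0 < L ->
  (x \notin `[a, a + L[ -> f x = 0) ->
  let v := half_periodization a L f in
  (f x = 0 /\ v x = translate L v x) \/ (v x = f x /\ translate L v x = 0).
Proof.
move=> L0; rewrite in_itv /= [translate L _ x]/translate.
have [ax|xa fx0] := leP a x; last first.
  by left; rewrite fx0// !half_periodization_lt//; lra.
have [xaL _|aLx fx0] := ltP x (a + L).
  right; rewrite (@half_periodization_itv _ _ _ 0)//; last by apply/andP; split; lra.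
  by rewrite half_periodization_lt ?/translate ?mulr0 ?subr0//; lra.
left; split; first by rewrite fx0// -leNgt.
(* If [x - L] lies in period [k], then [x] lies in period [k.+1], and both values are that of [f] at
   [x - L * k.+1%:R]. *)
have [k /andP[kx xk]] := itv_cover a L (x - L) L0 ltac:(lra).
rewrite (@half_periodization_itv _ _ _ k.+1)//.
  rewrite (@half_periodization_itv _ _ _ k)// ?kx//.
  by rewrite /translate -[k.+1]addn1 natrD; congr f; lra.
move: xk; rewrite -[k.+2]addn1 -[k.+1]addn1 !natrD => xk.
by apply/andP; split; lra.
Qed.

End HalfPeriodization.

Section Swindle.
Context {R : realType}.
Implicit Types (mu : Linf R -> R) (u v w : Linf R).

(** The clause on [P] transfers the sign of [u] to [v]. The disjunction says that [u] and the
    translate of [v] are, in some order, 0 and [v]; it mentions no sign, so it serves both signs of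
    [u]. *)
Lemma compact_support_telescope u : compact_support u ->
  exists v (t : R),
    (forall P : R -> Prop, P 0 -> (\forall x \ae (@leb R), P (u x)) ->
       \forall x \ae (@leb R), P (v x)) /\
    \forall x \ae (@leb R),
      (u x = 0 /\ v x = Linf_translate t v x) \/
      (v x = u x /\ Linf_translate t v x = 0).
Proof.
(* The summand 1 fits the closed interval from [a] to [b] into the half-open [[a, a + L[]; the
   maximum keeps [L] positive even if [b < a]. *)
move=> [a [b u0]]; pose L := Num.max 1 (b - a + 1).
have L0 : 0 < L by rewrite lt_max ltr01.
have bL : b < a + L.
  by have : b - a + 1 <= L by [rewrite le_max lexx orbT]; lra.
pose hv := Lfuny_half_periodization a L u L0 (LinfP u).
exists (Linf_of hv), L; split=> [P P0 Pu|].
  apply: filterS2 (Linf_ofE hv) (ae_half_periodization a L u P L0 P0 Pu).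
  by move=> x /(_ I) ->.
(* The translate can now be computed on the half-periodization itself instead of a chosen
   representative of its class. *)
rewrite Linf_translate_of.
have hvE := Linf_ofE hv; have htE := Linf_ofE (Lfuny_translate L hv).
apply: filterS3 hvE htE u0 => x /(_ I) -> /(_ I) -> u0.
apply: half_periodization_shift => // xaL; apply: u0; apply: contra xaL.
by rewrite !in_itv /= => /andP[-> xb]; exact: le_lt_trans xb bL.
Qed.

Lemma Linf_maxE u v : \forall x \ae (@leb R), Linf_max u v x = Num.max (u x) (v x).
Proof. by apply: filterS (Linf_ofE (Lfuny_max (LinfP u) (LinfP v))) => x; exact. Qed.

Lemma Linf_minE u v : \forall x \ae (@leb R), Linf_min u v x = Num.min (u x) (v x).
Proof. by apply: filterS (Linf_ofE (Lfuny_min (LinfP u) (LinfP v))) => x; exact. Qed.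

Lemma Linf0E : \forall x \ae (@leb R), Linf0 x = 0 :> R.
Proof. by apply: filterS (Linf_ofE Lfuny_cst0) => x; exact. Qed.

Lemma Linf_max_eq u v w :
  (\forall x \ae (@leb R), Num.max (u x) (v x) = w x) -> Linf_max u v = w.
Proof.
by move=> uvw; apply/Linf_eqP; apply: filterS2 (Linf_maxE u v) uvw => x -> ->.
Qed.

Lemma Linf_min_eq u v w :
  (\forall x \ae (@leb R), Num.min (u x) (v x) = w x) -> Linf_min u v = w.
Proof.
by move=> uvw; apply/Linf_eqP; apply: filterS2 (Linf_minE u v) uvw => x -> ->.
Qed.

Lemma valuation_compact_ge0 mu u : valuation mu -> translation_invariant mu ->
  compact_support u -> (\forall x \ae (@leb R), 0 <= u x) -> mu u = 0.
Proof.
move=> [mumm mu0] mut /compact_support_telescope[v [t [uv vt]]] u0.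
have v0 := uv (fun y => 0 <= y) (lexx 0) u0.
have vmax : Linf_max u (Linf_translate t v) = v.
  apply: Linf_max_eq; apply: filterS2 vt v0 => x [[-> <-]|[<- ->]] x0.
    exact: max_r.
  exact: max_l.
have vmin : Linf_min u (Linf_translate t v) = Linf0.
  apply: Linf_min_eq; apply: filterS3 Linf0E vt v0.
  move=> x -> [[-> <-]|[<- ->]] x0; first exact: min_l.
  exact: min_r.
(* The identity reads [mu v + 0 = mu u + mu v], and the real number [mu v] cancels. *)
by have := mumm u (Linf_translate t v); rewrite vmax vmin mu0 mut; lra.
Qed.

(** Same argument with the order reversed: now [v] is the meet and 0 the join. *)
Lemma valuation_compact_le0 mu u : valuation mu -> translation_invariant mu ->
  compact_support u -> (\forall x \ae (@leb R), u x <= 0) -> mu u = 0.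
Proof.
move=> [mumm mu0] mut /compact_support_telescope[v [t [uv vt]]] u0.
have v0 := uv (fun y => y <= 0) (lexx 0) u0.
have vmin : Linf_min u (Linf_translate t v) = v.
  apply: Linf_min_eq; apply: filterS2 vt v0 => x [[-> <-]|[<- ->]] x0.
    exact: min_r.
  exact: min_l.
have vmax : Linf_max u (Linf_translate t v) = Linf0.
  apply: Linf_max_eq; apply: filterS3 Linf0E vt v0.
  move=> x -> [[-> <-]|[<- ->]] x0; first exact: max_l.
  exact: max_r.
by have := mumm u (Linf_translate t v); rewrite vmax vmin mu0 mut; lra.
Qed.

End Swindle.

Theorem proposition3p3 (R : realType) (mu : Linf R -> R) :
  valuation mu -> translation_invariant mu ->
  forall u : Linf R, compact_support u -> mu u = 0.
Proof.
move=> muV mut u [a [b uab]]; have [mumm mu0] := muV.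
(* Against 0 the valuation identity splits [mu u] into the values at the join and the meet of [u]
   with 0, which have constant sign and inherit the support bounds of [u]. *)
have := mumm u Linf0; rewrite mu0 addr0 => <-.
rewrite valuation_compact_ge0// ?valuation_compact_le0 ?addr0//.
- exists a, b; apply: filterS3 Linf0E (Linf_minE u Linf0) uab.
  by move=> x x0 -> ux /ux ->; rewrite x0 minxx.
- by apply: filterS2 Linf0E (Linf_minE u Linf0) => x -> ->; rewrite ge_min lexx orbT.
- exists a, b; apply: filterS3 Linf0E (Linf_maxE u Linf0) uab.
  by move=> x x0 -> ux /ux ->; rewrite x0 maxxx.
- by apply: filterS2 Linf0E (Linf_maxE u Linf0) => x -> ->; rewrite le_max lexx orbT.
Qed.
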